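(* Let $C_\phi$ be a composition operator on a directed graph with one circuit (as defined in the context) with $\kappa=1$, suppose $C_\phi\in\boldsymbol B(L^2(\mu))$ and let $m\ge2$ be an integer. Then $C_\phi$ is an $m$-isometry if and only if $\mu(x_{i,j+1})$ is a polynomial in $j$ of degree at most $m-2$ for every $i\in J_{[1,\eta]}$. Moreover, if this condition holds and there exists $i_0\in J_{[1,\eta]}$ such that $\mu(x_{i_0,j+1})$ is a polynomial in $j$ of degree $m-2$, then $C_\phi$ is a strict $m$-isometry.
   Context: Setting. $\mathbb N=\{1,2,\ldots\}$, $\mathbb Z_+=\{0,1,2,\ldots\}$. Let $\kappa\in\mathbb N$, $\eta\in\mathbb N\cup\{\infty\}$, $J_{[1,\eta]}=\{i\in\mathbb N: i\le\eta\}$ (so $J_{[1,\infty]}=\mathbb N$), and let $X=\{x_1,\ldots,x_\kappa\}\cup\{x_{i,j}: i\in J_{[1,\eta]},\, j\in\mathbb N\}$, all the listed points being distinct. Let $\mathscr A$ be the $\sigma$-algebra of all subsets of $X$ and $\mu$ a positive measure on $\mathscr A$ with $\mu(x):=\mu(\{x\})\in(0,\infty)$ for all $x\in X$. Define $\phi\colon X\to X$ by $\phi(x_{i,j})=x_{i,j-1}$ for $j\ge2$, $\phi(x_{i,1})=x_\kappa$, $\phi(x_1)=x_\kappa$, and $\phi(x_i)=x_{i-1}$ for $2\le i\le\kappa$. The operator $C_\phi f=f\circ\phi$ in the complex space $L^2(\mu)=L^2(X,\mathscr A,\mu)$ is called a composition operator on a directed graph with one circuit. $C_\phi\in\boldsymbol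 B(L^2(\mu))$ means that $C_\phi$ is everywhere defined and bounded on $L^2(\mu)$. A bounded operator $T$ on a Hilbert space is an $m$-isometry if $\sum_{k=0}^m(-1)^k\binom mk T^{*k}T^k=0$. An $m$-isometry $T$ is strict if $T$ is an isometry (case $m=1$) or $m\ge2$ and $T$ is not an $(m-1)$-isometry. A real sequence $\{\gamma_n\}_{n=0}^\infty$ is said to be a polynomial in $n$ (of degree $k$, respectively of degree at most $k$) if there is a real polynomial $p$ (of degree $k$, respectively of degree at most $k$) with $p(n)=\gamma_n$ for all $n\in\mathbb Z_+$. *)

(* Defs.v *)
From HB Require Import structures.
From mathcomp Require Import all_boot all_order all_algebra.
From mathcomp Require Import all_classical all_reals all_analysis.
From mathcomp Require Import complex.

Set Implicit Arguments.
Unset Strict Implicit.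
Unset Printing Implicit Defensive.

Import Order.TTheory GRing.Theory Num.Theory.

Local Open Scope classical_set_scope.
Local Open Scope ring_scope.

(* A Hilbert space is given as a subset H of a complex vector space V together
   with the restriction to H of ip : V -> V -> R[i], linear in the first
   argument. Operators are functions V -> V of which only the restriction
   to H matters. *)
Section Operators.
Context {R : realType} {V : lmodType R[i]}.
Variables (H : set V) (ip : V -> V -> R[i]).
Implicit Types (T S : V -> V).

Definition hnorm (f : V) : R := Num.sqrt (complex.Re (ip f f)).

(* Everywhere defined and bounded; linearity is stated with the rest so that
   this is membership in B(H). *)
Definition bounded_operator T : Prop :=
  [/\ forall f, H f -> H (T f),
      forall (a : R[i]) f g, H f -> H g -> T (a *: f + g) = a *: T f + T g &
      exists c : R, forall f, H f -> hnorm (T f) <= c * hnorm f].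

Definition is_adjoint T S : Prop :=
  (forall f, H f -> H (S f)) /\
  (forall f g, H f -> H g -> ip (T f) g = ip f (S g)).

(* S stands for T^*: it exists for every bounded T and is unique on H. *)
Definition m_isometry (m : nat) T : Prop :=
  bounded_operator T /\
  exists2 S, is_adjoint T S &
    forall f, H f ->
      \sum_(0 <= k < m.+1)
        ((-1) ^+ k * 'C(m, k)%:R) *: iter k S (iter k T f) = 0.

Definition isometry T : Prop := forall f, H f -> hnorm (T f) = hnorm f.

Definition strict_m_isometry (m : nat) T : Prop :=
  m_isometry m T /\
  ((m = 1%N /\ isometry T) \/ ((2 <= m)%N /\ ~ m_isometry m.-1 T)).

End Operators.

(* The complex space L^2(mu), without passing to classes of functions equal
   almost everywhere: the quotient is trivial when every singleton has positive
   measure, the only case used here. *)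
Section L2.
Context d {T : measurableType d} {R : realType}.
Variable mu : {measure set T -> \bar R}.

Definition L2 : set (T -> R[i]) := [set f |
  [/\ measurable_fun setT (fun x => complex.Re (f x) : R),
      measurable_fun setT (fun x => complex.Im (f x) : R) &
      (\int[mu]_x ((complex.Re (f x) ^+ 2 + complex.Im (f x) ^+ 2)%:E)
        < +oo)%E]].

Definition L2_inner (f g : T -> R[i]) : R[i] :=
  Complex (\int[mu]_x complex.Re (f x * conjc (g x)))
          (\int[mu]_x complex.Im (f x * conjc (g x))).

End L2.

(* J_[1,eta], with eta = None standing for infinity. *)
Definition in_branches (eta : option nat) : pred nat :=
  fun i => (0 < i)%N && (if eta is Some n then (i <= n)%N else true).

Definition branches (eta : option nat) : Type := {i : nat | in_branches eta i}.

HB.instance Definition _ (eta : option nat) :=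
  Countable.copy (branches eta) {i : nat | in_branches eta i}.

(* The set X for kappa = k + 1. *)
Definition vertex (k : nat) (eta : option nat) : Type :=
  ('I_k.+1 + branches eta * nat)%type.

Section Graph.
Variables (k : nat) (eta : option nat).

(* Indices start at 0: x_circ i is x_{i+1}, and x_branch i j is x_{i,j+1}. *)
Definition x_circ (i : 'I_k.+1) : vertex k eta := inl i.
Definition x_branch (i : branches eta) (j : nat) : vertex k eta := inr (i, j).

Definition phi (x : vertex k eta) : vertex k eta :=
  match x with
  | inl i => if i == ord0 then x_circ ord_max else x_circ (inord i.-1)
  | inr (i, 0%N) => x_circ ord_max
  | inr (i, j.+1) => x_branch i j
  end.

HB.instance Definition _ := Countable.copy (vertex k eta)
  ('I_k.+1 + branches eta * nat)%type.
HB.instance Definition _ := isPointed.Build (vertex k eta) (x_circ ord0).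
HB.instance Definition _ := @isMeasurable.Build default_measure_display
  (vertex k eta) discrete_measurable discrete_measurable0
  discrete_measurableC discrete_measurableU.

End Graph.

Definition composition_operator {X C : Type} (h : X -> X) (f : X -> C) : X -> C :=
  f \o h.

Definition polynomial_of_degree_le {R : nzRingType} (n : nat) (u : nat -> R) :=
  exists2 p : {poly R}, (size p <= n.+1)%N & forall j, p.[j%:R] = u j.

Definition polynomial_of_degree {R : nzRingType} (n : nat) (u : nat -> R) :=
  exists2 p : {poly R}, size p = n.+1 & forall j, p.[j%:R] = u j.

(* Main.v *)
Require Import Defs.
From mathcomp Require Import all_boot all_order all_algebra.
From mathcomp Require Import all_classical all_reals all_analysis.
From mathcomp Require Import complex.
From mathcomp Require Import ring lra.

Set Implicit Arguments.
Unset Strict Implicit.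
Unset Printing Implicit Defensive.

Import Order.TTheory GRing.Theory Num.Theory numFieldNormedType.Exports.
Local Open Scope classical_set_scope.
Local Open Scope ring_scope.

(** Write [C] for the composition operator of [h] on a countable set with point
masses. Since [C^n] sends the indicator of a point [y] to the indicator of the
preimage of [y] under [h^n], testing an adjoint [S] against this indicator gives
[S^n C^n f (y) = mu (h^-n y) / mu y * f y], whatever [f] is. Thus [C] is an
[m]-isometry if and only if, for every point [y], the alternating binomial sum of
[n |-> mu (h^-n y)], that is up to sign its [m]-th finite difference at [0],
vanishes ([m_isometry_compositionP]). An adjoint [S] is obtained by summing over
the fibres of [h].

On the graph whose circuit is a loop at the root [r], the preimage of the [j]-th
point of a branch under [phi^n] is the [(j + n)]-th point of the same branch, so
the condition at the points of branch [b] says that the [m]-th difference of its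
weight sequence [w_b] is identically zero. The preimages of [r] under [phi^n] grow
with [n], and going from [n] to [n + 1] adds the [n]-th points of all branches; so
the condition at [r] says that the [(m-1)]-st differences of the [w_b] at [0] add
up to zero.

The two conditions together force each of these [(m-1)]-st differences to vanish.
By the first one each is constant along its branch, and the constant is
nonnegative, since a sequence whose iterated difference is a negative constant is
eventually negative ([fdiff_const_ge0]), whereas weights are positive. A sum of
nonnegative numbers that is zero has zero terms. Hence [C] is an [(m+1)]-isometry
if and only if the [m]-th differences of all weight sequences vanish
([m_isometry_fdiffP]), which by Newton interpolation means that they are
polynomials of size at most [m] ([iter_fdiff_eq0P]). Strictness follows because the
polynomial interpolating a sequence is unique, so that a weight sequence of degree
exactly [m - 2] does not satisfy the criterion for [m - 1]. *)

(** * Finite differences and polynomial sequences *)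

Section FiniteDifferences.
Context {R : realType}.
Implicit Types (u v : nat -> R) (p : {poly R}) (n j : nat).

Definition fdiff u : nat -> R := fun j => u j.+1 - u j.

Lemma eq_iter_fdiff n u v : u =1 v -> iter n fdiff u =1 iter n fdiff v.
Proof. by move=> /funext ->. Qed.

Lemma iter_fdiff_shift n u j : iter n fdiff (fun l => u (j + l)%N) 0%N =
  iter n fdiff u j.
Proof.
elim: n u j => [|n IHn] u j; first by rewrite /= addn0.
rewrite !iterSr -(IHn (fdiff u)); apply: eq_iter_fdiff => l.
by rewrite /fdiff addnS.
Qed.

Lemma iter_fdiff_sum n u : iter n fdiff u 0%N =
  (-1) ^+ n * \sum_(0 <= i < n.+1) (-1) ^+ i * 'C(n, i)%:R * u i.
Proof.
elim: n u => [|n IHn] u.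
  by rewrite /= big_nat1 bin0 !expr0 !mul1r.
rewrite iterSr IHn exprS -mulrA mulrCA; congr (_ * _).
rewrite [in RHS]big_nat_recl // bin0 expr0 !mul1r.
under [in RHS]eq_bigr => i _.
  rewrite binS natrD mulrDr mulrDl; over.
rewrite big_split /=.
rewrite [X in _ = _ * (_ + (X + _))]big_nat_recr //= bin_small // mulr0 mul0r addr0.
rewrite addrA.
rewrite [X in X + _](_ : _ = \sum_(0 <= i < n.+1) (-1) ^+ i * 'C(n, i)%:R * u i).
  rewrite mulN1r -big_split -sumrN /=; apply: eq_bigr => i _.
  by rewrite /fdiff exprS; ring.
by rewrite [in RHS]big_nat_recl // bin0 expr0 !mul1r.
Qed.

Lemma polynomial_eq0 p : (forall j, p.[j%:R] = 0) -> p = 0.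
Proof.
move=> p0; apply/eqP/negP => /negP pn0.
have := @max_poly_roots _ p [seq i%:R | i <- iota 0 (size p)] pn0.
rewrite size_map size_iota ltnn => H; apply/notF/H.
  by apply/allP => _ /mapP[i _ ->]; rewrite rootE p0.
rewrite map_inj_uniq ?iota_uniq//.
by move=> i j /eqP; rewrite eqr_nat => /eqP.
Qed.

(** The translate of [p] by [1] has the same degree and leading coefficient as [p],
so the leading terms cancel. *)
Lemma size_shift_sub n p : (size p <= n.+1)%N ->
  (size (p \Po ('X + 1%:P) - p)%R <= n)%N.
Proof.
move=> sp.
have sX : size ('X + 1%:P : {poly R}) = 2%N by rewrite size_XaddC.
have sc : size (p \Po ('X + 1%:P)) = size p by rewrite size_comp_poly2.
apply/leq_sizeP => i ni; rewrite coefB.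
have [sip|ips] := leqP (size p) i.
  by rewrite !nth_default ?subrr ?sc.
have pi : i = (size p).-1.
  apply/eqP; rewrite eqn_leq -ltnS (ltn_predK ips) ips /=.
  by rewrite (leq_trans _ ni)// -ltnS (ltn_predK ips).
have /(_ _ p ('X + 1%:P)) := lead_coef_comp.
rewrite sX => /(_ isT); rewrite lead_coefXaddC expr1n mulr1.
by rewrite /lead_coef sc -pi => ->; rewrite subrr.
Qed.

Lemma iter_fdiff_poly n p : (size p <= n)%N ->
  iter n fdiff (fun j => p.[j%:R]) =1 fun=> 0.
Proof.
elim: n p => [|n IHn] p sp j.
  by move: sp; rewrite leqn0 size_poly_eq0 => /eqP -> /=; rewrite horner0.
rewrite iterSr -(IHn _ (size_shift_sub sp) j); apply: eq_iter_fdiff => l.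
by rewrite /fdiff !hornerE horner_comp !hornerE -natr1.
Qed.

(** Newton's forward formula, truncated at the first vanishing difference. *)
Lemma newton_forward n u : iter n fdiff u =1 (fun=> 0) ->
  forall j, u j = \sum_(i < n) 'C(j, i)%:R * iter i fdiff u 0%N.
Proof.
elim: n u => [|n IHn] u u0 j; first by rewrite big_ord0 -(u0 j).
have /IHn du : iter n fdiff (fdiff u) =1 (fun=> 0) by move=> l; rewrite -iterSr.
rewrite big_ord_recl bin0 mul1r /=.
elim: j => [|j IHj].
  by rewrite big1 ?addr0// => i _; rewrite bin0n mul0r.
rewrite -[LHS](subrK (u j)) -/(fdiff u j) du [X in _ + X]IHj.
rewrite addrC -addrA -big_split /=; congr (_ + _); apply: eq_bigr => i _.
by rewrite -!iterSr -iterS /bump /= add1n binS natrD mulrDl.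
Qed.

Definition binom_poly n : {poly R} :=
  (n`!%:R)^-1 *: \prod_(i < n) ('X - i%:R%:P).

Lemma horner_binom_poly n j : (binom_poly n).[j%:R] = 'C(j, n)%:R.
Proof.
have n0 : n`!%:R != 0 :> R by rewrite pnatr_eq0 -lt0n fact_gt0.
apply: (mulfI n0); rewrite hornerZ mulVKf// -natrM mulnC bin_ffact.
rewrite horner_prod ffact_prod natr_prod.
have [nj|jn] := leqP n j.
  apply: eq_bigr => i _; rewrite !hornerE natrB//.
  by rewrite ltnW// (leq_trans (ltn_ord i)).
rewrite (bigD1 (Ordinal jn)) //= !hornerE subrr mul0r.
by rewrite (bigD1 (Ordinal jn)) //= subnn mul0r.
Qed.

Lemma size_binom_poly n : (size (binom_poly n) <= n.+1)%N.
Proof.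
apply: (leq_trans (size_scale_leq _ _)).
by rewrite size_prod_XsubC /index_enum -enumT size_enum_ord.
Qed.

Lemma iter_fdiff_eq0P n u :
  iter n fdiff u =1 (fun=> 0) <->
  exists2 p : {poly R}, (size p <= n)%N & forall j, p.[j%:R] = u j.
Proof.
split=> [u0|[p sp pu] j]; last first.
  by rewrite -(iter_fdiff_poly sp j); apply: eq_iter_fdiff => l; rewrite pu.
exists (\sum_(i < n) iter i fdiff u 0%N *: binom_poly i).
  apply: (leq_trans (size_sum _ _ _)); apply/bigmax_leqP => i _.
  apply: (leq_trans (size_scale_leq _ _)).
  by apply: (leq_trans (size_binom_poly _)).
move=> j; rewrite horner_sum (newton_forward u0); apply: eq_bigr => i _.
by rewrite hornerZ horner_binom_poly mulrC.
Qed.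

(** The bound away from [0] is what makes this property pass from the difference of
a sequence to the sequence itself, which then tends to minus infinity. *)
Definition eventually_neg u :=
  exists2 e, 0 < e & exists N, forall j, (N <= j)%N -> u j <= - e.

Lemma eventually_neg_fdiff n u :
  eventually_neg (iter n fdiff u) -> eventually_neg u.
Proof.
elim: n u => [//|n IHn] u; rewrite iterSr => /IHn[e e0 [N ue]].
have uN j : u (N + j)%N <= u N - e *+ j.
  elim: j => [|j IHj]; first by rewrite addn0 mulr0n subr0.
  have := ue (N + j)%N (leq_addr _ _); rewrite /fdiff addnS mulrSr.
  by move: IHj; lra.
(* from [N] on, [u] decreases by at least [e] at each step, so it is below [-1]
   after [(u N + 1) / e] further steps *)
exists 1 => //; exists (N + Num.bound `|(u N + 1) / e|)%N => j.
move=> /subnKC <-; rewrite -addnA; apply: (le_trans (uN _)).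
set b := Num.bound _; set l := (j - _)%N.
rewrite -mulr_natl lerBlDr addrC -lerBlDr opprK -ler_pdivrMr//.
apply: (le_trans (ler_norm _)); apply: ltW.
apply: (lt_le_trans (archi_boundP (normr_ge0 _))).
by rewrite ler_nat leq_addr.
Qed.

(** A negative constant difference would make a positive sequence eventually
negative. *)
Lemma fdiff_const_ge0 n u : (forall j, 0 < u j) ->
  iter n.+1 fdiff u =1 (fun=> 0) -> forall j, 0 <= iter n fdiff u j.
Proof.
move=> u0 du j; rewrite leNgt; apply/negP => dn0.
have dc l : iter n fdiff u l = iter n fdiff u 0%N.
  elim: l => // l <-; apply/eqP; rewrite -subr_eq0; apply/eqP.
  exact: (du l).
have [|e e0 [N /(_ _ (leqnn N))]] := @eventually_neg_fdiff n u.
  exists (- iter n fdiff u j); first by rewrite oppr_gt0.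
  by exists 0%N => l _; rewrite opprK !dc.
by apply/negP; rewrite -ltNge (lt_trans _ (u0 N))// oppr_lt0.
Qed.

Lemma cvg_iter_fdiff (v : nat -> nat -> R) (s : nat -> R) n :
  (forall j, \sum_(0 <= i < N) v i j @[N --> \oo] --> s j) ->
  forall j, \sum_(0 <= i < N) iter n fdiff (v i) j @[N --> \oo] --> iter n fdiff s j.
Proof.
move=> vs; elim: n => [//|n IHn] j.
rewrite /= /fdiff; under eq_fun do rewrite sumrB.
by apply: cvgB; exact: IHn.
Qed.

Lemma cvg_sum_ge0_eq0 (a : nat -> R) : (forall i, 0 <= a i) ->
  \sum_(0 <= i < N) a i @[N --> \oo] --> (0 : R) -> forall i, a i = 0.
Proof.
move=> a0 ca i; apply/eqP; rewrite eq_le a0 andbT.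
have nd : {homo (fun N => \sum_(0 <= i < N) a i) : x y / (x <= y)%N >-> x <= y}.
  move=> x y xy; rewrite (big_cat_nat (leq0n x) xy)//= lerDl.
  exact: sumr_ge0.
have := nondecreasing_cvgn_le nd (cvgP _ ca) i.+1.
rewrite (cvg_lim _ ca)//; apply: le_trans.
by rewrite big_nat_recr//= lerDr sumr_ge0.
Qed.

End FiniteDifferences.

(** * Square-integrable functions on a countable discrete space *)

Section DiscreteL2.
Context {d : measure_display} {T : measurableType d} {R : realType}.
Variables (mu : {measure set T -> \bar R}) (q : T -> nat).
Hypothesis measurable_all : forall A : set T, measurable A.
Hypothesis q_inj : injective q.
Hypothesis mu_point : forall x : T, (0 < mu [set x] < +oo)%E.

Lemma measurable_fun_all d' (U : measurableType d') (D : set T) (f : T -> U) :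
  measurable_fun D f.
Proof. by move=> _ Y _; exact: measurable_all. Qed.
Hint Resolve measurable_all measurable_fun_all : core.

Definition mass (x : T) : R := fine (mu [set x]).

Lemma mu_massE x : mu [set x] = (mass x)%:E.
Proof.
have /andP[m0 mlt] := mu_point x.
by rewrite /mass fineK// ge0_fin_numE.
Qed.

Lemma mass_gt0 x : 0 < mass x.
Proof. by have /andP[] := mu_point x; rewrite mu_massE lte_fin. Qed.

Lemma integral_point (g : T -> \bar R) y :
  (\int[mu]_(x in [set y]) g x = g y * (mass y)%:E)%E.
Proof.
rewrite -mu_massE -integral_cst//.
by apply: eq_integral => x; rewrite inE => ->.
Qed.

Definition sqint (u : T -> R) : Prop :=
  mu.-integrable setT (EFin \o (fun x => u x ^+ 2)).

Lemma sqintP u : sqint u <-> (\int[mu]_x ((u x ^+ 2)%:E) < +oo)%E.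
Proof.
rewrite /sqint; split=> [/integrableP[_]|u2].
  by under eq_integral do rewrite /= ger0_norm ?sqr_ge0//.
apply/integrableP; split=> //.
by under eq_integral do rewrite /= ger0_norm ?sqr_ge0//.
Qed.

(** The adjoint of a composition operator acts on real and imaginary parts
separately, so its study reduces to real square-integrable functions. *)
Lemma L2P (f : T -> R[i]) :
  L2 mu f <-> sqint (fun x => complex.Re (f x)) /\ sqint (fun x => complex.Im (f x)).
Proof.
split=> [[_ _ f2]|[fr fi]].
  split; apply/sqintP; apply: le_lt_trans f2; apply: ge0_le_integral => //.
  - by move=> x _; rewrite lee_fin sqr_ge0.
  - by move=> x _; rewrite lee_fin lerDl sqr_ge0.
  - by move=> x _; rewrite lee_fin sqr_ge0.
  - by move=> x _; rewrite lee_fin lerDr sqr_ge0.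
split=> //.
under eq_integral do rewrite EFinD.
have := integrableD measurableT fr fi.
move=> /integrableP[_]; apply: le_lt_trans.
rewrite le_eqVlt; apply/orP; left; apply/eqP; apply: eq_integral => x _ /=.
by rewrite ger0_norm ?addr_ge0 ?sqr_ge0.
Qed.

Lemma integrable_mul (a b : T -> R) : sqint a -> sqint b ->
  mu.-integrable setT (EFin \o (fun x => a x * b x)).
Proof.
move=> ia ib; apply: le_integrable (integrableD measurableT ia ib) => //.
move=> x _ /=; rewrite lee_fin [leRHS]ger0_norm ?addr_ge0 ?sqr_ge0//.
rewrite normrM; have := sqr_ge0 (`|a x| - `|b x|).
rewrite -[a x ^+ 2]real_normK ?num_real// -[b x ^+ 2]real_normK ?num_real//.
by have := normr_ge0 (a x); have := normr_ge0 (b x); nra.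
Qed.

(** The fibres of [h] are indexed by [nat] through the enumeration [q], with empty
fibres at unused indices, in order to apply countable additivity. *)
Definition fiber (h : T -> T) (n : nat) : set T := h @^-1` (q @^-1` [set n]).

Lemma fiberE n : (exists y, forall h : T -> T, fiber h n = h @^-1` [set y]) \/
  (forall h : T -> T, fiber h n = set0).
Proof.
have [[y <-]|nq] := pselect (exists y, q y = n).
  left; exists y => h'; apply/seteqP; split=> x; first exact: q_inj.
  by rewrite /fiber /preimage /= => ->.
by right => h'; apply/seteqP; split=> x //= qx; apply: nq; exists (h' x).
Qed.

Lemma bigcup_fiber h : \bigcup_n fiber h n = setT.
Proof. by apply/seteqP; split=> // x _; exists (q (h x)). Qed.

Lemma trivIset_fiber h : trivIset setT (fiber h).
Proof. by move=> i j _ _ [x [/= <- <-]]. Qed.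

(** Integrals over the space are compared fibre by fibre: [g] is grouped along the
fibres of [h], and [f] along points. *)
Lemma fiber_integral_le h (f g : T -> \bar R) :
  (forall x, 0 <= f x)%E -> (forall x, 0 <= g x)%E ->
  (forall y, \int[mu]_(x in [set y]) f x <= \int[mu]_(x in h @^-1` [set y]) g x)%E ->
  (\int[mu]_x f x <= \int[mu]_x g x)%E.
Proof.
move=> f0 g0 fg.
rewrite -[X in integral _ X f](bigcup_fiber id) -(bigcup_fiber h).
rewrite !ge0_integral_bigcup//; try exact: trivIset_fiber.
apply: lee_nneseries => [n _ _|n _]; first exact: integral_ge0.
have [[y yE]|nE] := fiberE n; last by rewrite !nE !integral_set0.
by rewrite !yE; exact: fg.
Qed.

Lemma fiber_integral_eq h (f g : T -> \bar R) :
  mu.-integrable setT f -> mu.-integrable setT g ->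
  (forall y, \int[mu]_(x in h @^-1` [set y]) f x = \int[mu]_(x in [set y]) g x)%E ->
  (\int[mu]_x f x = \int[mu]_x g x)%E.
Proof.
move=> f0 g0 fg.
rewrite -[X in integral _ X g](bigcup_fiber id) -(bigcup_fiber h).
rewrite !integral_bigcup ?bigcup_fiber//; try exact: trivIset_fiber.
apply: eq_eseriesr => n _.
have [[y yE]|nE] := fiberE n; last by rewrite !nE !integral_set0.
by rewrite !yE fg.
Qed.

Section Fiberwise.
Variables (h : T -> T) (M : R).
Hypothesis M_gt0 : 0 < M.
Hypothesis mu_fiber : forall y, (mu (h @^-1` [set y]) <= (M * mass y)%:E)%E.

(** The real form of the adjoint of composition with [h]. *)
Definition fiber_sum (u : T -> R) (y : T) : R :=
  (\int[mu]_(x in h @^-1` [set y]) u x) / mass y.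

Lemma fiber_sqint y u : sqint u ->
  mu.-integrable (h @^-1` [set y]) (EFin \o (fun x => u x ^+ 2)).
Proof. by apply: integrableS. Qed.

Lemma mu_fiber_lty y : (mu (h @^-1` [set y]) < +oo)%E.
Proof. by apply: le_lt_trans (mu_fiber y) _; rewrite ltry. Qed.

Lemma fiber_cst_integrable y (t : R) :
  mu.-integrable (h @^-1` [set y]) (EFin \o cst t).
Proof.
apply/integrableP; split => //.
under eq_integral do rewrite /=.
by rewrite integral_cst// lte_mul_pinfty// mu_fiber_lty.
Qed.

Lemma fiber_integrable y u : sqint u ->
  mu.-integrable (h @^-1` [set y]) (EFin \o u).
Proof.
move=> /(fiber_sqint y) iu.
apply: le_integrable (integrableD _ (fiber_cst_integrable y 1) iu) => //.
move=> x _ /=; rewrite lee_fin [leRHS]ger0_norm ?addr_ge0 ?sqr_ge0//.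
rewrite -[u x ^+ 2]real_normK ?num_real//.
by have := sqr_ge0 (`|u x| - 1); nra.
Qed.

(** The Cauchy-Schwarz inequality on one fibre, whose measure is at most
[M * mass y]. *)
Lemma fiber_sum_sqr_le y u : sqint u ->
  fiber_sum u y ^+ 2 * mass y <= M * \int[mu]_(x in h @^-1` [set y]) (u x ^+ 2).
Proof.
move=> iu; have m0 := mass_gt0 y; set A := h @^-1` [set y].
set s := fiber_sum u y.
have su : \int[mu]_(x in A) u x = s * mass y by rewrite /s /fiber_sum divfK ?gt_eqF.
(* the lower bound for [u ^+ 2] coming from [0 <= (u - t) ^+ 2] integrates to
   [2 * t * s * mass y - t ^+ 2 * mu A], and [t = s / M] is the best value once
   [mu A] is replaced by [M * mass y] *)
pose t := s / M.
have : 0 <= \int[mu]_(x in A) (u x ^+ 2 + (- (2 * t) * u x + t ^+ 2)).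
  apply: Rintegral_ge0 => x _.
  by have := sqr_ge0 (u x - t); nra.
have i1 := fiber_integrable y iu.
have i2 := fiber_cst_integrable y (t ^+ 2).
have i3 : mu.-integrable A (EFin \o (fun x => - (2 * t) * u x)).
  have := integrableZl (measurable_all A) (- (2 * t)) i1.
  by apply: eq_integrable.
rewrite RintegralD//; last 2 first.
- exact: fiber_sqint.
- exact: (integrableD _ i3 i2).
rewrite RintegralD// RintegralZl// Rintegral_cst// su.
have : fine (mu A) <= M * mass y.
  rewrite -lee_fin fineK ?mu_fiber//.
  by rewrite ge0_fin_numE// mu_fiber_lty.
set I := (X in 0 <= X + _ -> _).
set a := fine _.
move=> aM.
have t2a : t ^+ 2 * a <= t ^+ 2 * (M * mass y) by rewrite ler_wpM2l// sqr_ge0.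
move=> H; have {}H : 0 <= I - 2 * t * (s * mass y) + t ^+ 2 * (M * mass y) by lra.
have tM : s = t * M by rewrite /t divfK// gt_eqF.
move: H; rewrite tM => H.
have {}H : t ^+ 2 * M * mass y <= I by lra.
have : M * (t ^+ 2 * M * mass y) <= M * I by rewrite ler_pM2l.
by rewrite -/I; apply: le_trans; rewrite le_eqVlt; apply/orP; left; apply/eqP; ring.
Qed.

Lemma fiber_sum_sqint u : sqint u -> sqint (fiber_sum u).
Proof.
move=> iu; apply/sqintP.
apply: (@le_lt_trans _ _ (\int[mu]_x (M * u x ^+ 2)%:E)%E).
  apply: (@fiber_integral_le h).
  - by move=> x; rewrite lee_fin sqr_ge0.
  - by move=> x; rewrite lee_fin mulr_ge0 ?sqr_ge0// ltW.
  move=> y; rewrite integral_point -EFinM.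
  under eq_integral do rewrite EFinM.
  rewrite integralZl//; last exact: fiber_sqint.
  rewrite -[X in (_ <= _ * X)%E]fineK; last first.
    by apply: integrable_fin_num => //; exact: fiber_sqint.
  by rewrite -EFinM lee_fin; exact: fiber_sum_sqr_le.
under eq_integral do rewrite EFinM.
rewrite ge0_integralZl//; last 2 first.
- by move=> x _; rewrite lee_fin sqr_ge0.
- by rewrite lee_fin ltW.
by apply: lte_mul_pinfty => //; [rewrite lee_fin ltW|exact/sqintP].
Qed.

Lemma fiber_sum_adjoint a u : sqint (a \o h) -> sqint a -> sqint u ->
  \int[mu]_x (a (h x) * u x) = \int[mu]_x (a x * fiber_sum u x).
Proof.
move=> ih ia iu; rewrite /Rintegral; congr fine.
apply: (@fiber_integral_eq h).
- exact: integrable_mul.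
- by apply: integrable_mul => //; exact: fiber_sum_sqint.
move=> y; rewrite integral_point -EFinM.
transitivity (\int[mu]_(x in h @^-1` [set y]) ((a y)%:E * (u x)%:E))%E.
  by apply: eq_integral => x; rewrite inE /= => <-; rewrite EFinM.
rewrite integralZl//; last exact: fiber_integrable.
rewrite -[X in (_ * X)%E]fineK; last first.
  by apply: integrable_fin_num => //; exact: fiber_integrable.
rewrite -EFinM -mulrA /fiber_sum divfK// gt_eqF// mass_gt0//.
Qed.

End Fiberwise.

(** * Composition operators on a countable discrete space *)

Section CompositionOperator.
Variable h : T -> T.
Local Notation Ch := (@composition_operator T R[i] h).
Hypothesis Ch_bounded : bounded_operator (L2 mu) (L2_inner mu) Ch.

Definition indC (A : set T) : T -> R[i] := fun x => Complex (\1_A x) 0.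

Definition preim_mass (n : nat) (y : T) : R := fine (mu (iter n h @^-1` [set y])).

Lemma iter_compositionE n f : iter n Ch f = f \o iter n h.
Proof.
elim: n => [//|n IHn]; rewrite iterSr /composition_operator.
by elim: n {IHn} f => [//|n IHn] f; rewrite iterSr IHn.
Qed.

Lemma L2_indC A : L2 mu (indC A) <-> (mu A < +oo)%E.
Proof.
have H : (\int[mu]_x ((complex.Re (indC A x) ^+ 2 + complex.Im (indC A x) ^+ 2)%:E)
    = mu A)%E.
  rewrite -[A in RHS]setIT -integral_indic//; apply: eq_integral => x _ /=.
  by rewrite expr0n addr0 indicE; case: (_ \in _); rewrite ?expr1n ?expr0n.
by split=> [[_ _]|Afin]; [rewrite H|split=> //; rewrite H].
Qed.

Lemma inner_indC A g z : (forall x, A x -> g x = z) ->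
  L2_inner mu (indC A) g =
  Complex (complex.Re z * fine (mu A)) (- complex.Im z * fine (mu A)).
Proof.
move=> gz; rewrite /L2_inner.
rewrite -!Rintegral_cst// !(Rintegral_mkcond _ A).
congr Complex; apply: eq_Rintegral => x _; rewrite patchE /indC indicE.
case: ifPn => [/set_mem/gz ->|_]; [case: z {gz}|case: (g x)] => a b /=.
    by ring.
  by rewrite !mul0r subr0.
case: ifPn => [/set_mem/gz ->|_]; [case: z {gz}|case: (g x)] => a b /=.
  by ring.
by rewrite !mul0r addr0.
Qed.

Lemma iter_composition_L2 n f : L2 mu f -> L2 mu (iter n Ch f).
Proof.
have [CL _ _] := Ch_bounded.
by move=> Lf; elim: n => //= n; exact: CL.
Qed.

Lemma L2_point y : L2 mu (indC [set y]).
Proof. by apply/L2_indC; have /andP[] := mu_point y. Qed.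

Lemma iter_composition_indC n A : iter n Ch (indC A) = indC (iter n h @^-1` A).
Proof. by rewrite iter_compositionE. Qed.

(** The [n]-th power of the operator maps the indicator of [y] into [L2], which
forces the preimage of [y] to have finite measure. *)
Lemma mu_preim_fin n y : mu (iter n h @^-1` [set y]) \is a fin_num.
Proof.
rewrite ge0_fin_numE//; apply/L2_indC; rewrite -iter_composition_indC.
exact/iter_composition_L2/L2_point.
Qed.

Lemma hnorm_indC A : hnorm (L2_inner mu) (indC A) = Num.sqrt (fine (mu A)).
Proof.
rewrite /hnorm (@inner_indC A _ (Complex 1 0)) /= ?mul1r//.
by move=> x Ax; rewrite /indC indicE mem_set.
Qed.

(** The operator norm bound on the indicators of points. *)
Lemma mu_fiber_bounded : exists2 M : R, 0 < M &
  forall y, (mu (h @^-1` [set y]) <= (M * mass y)%:E)%E.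
Proof.
have [_ _ [c cP]] := Ch_bounded.
exists (c ^+ 2 + 1); first by rewrite ltr_wpDl// sqr_ge0.
move=> y; rewrite -[mu _]fineK ?lee_fin; last exact: (mu_preim_fin 1).
have := cP _ (L2_point y).
rewrite -/(iter 1 Ch _) iter_composition_indC !hnorm_indC -/(mass y) /=.
set a := fine _ => ac.
have a0 : 0 <= a by exact: fine_ge0.
have m0 := mass_gt0 y.
have : Num.sqrt a ^+ 2 <= (c * Num.sqrt (mass y)) ^+ 2.
  by rewrite lerXn2r// nnegrE ?sqrtr_ge0// (le_trans _ ac)// sqrtr_ge0.
by rewrite exprMn !sqr_sqrtr// ?(ltW m0)//; lra.
Qed.

Lemma composition_adjoint_exists :
  exists S, is_adjoint (L2 mu) (L2_inner mu) Ch S.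
Proof.
have [M M0 hM] := mu_fiber_bounded.
have [CL _ _] := Ch_bounded.
exists (fun g y => Complex (fiber_sum h (fun x => complex.Re (g x)) y)
                           (fiber_sum h (fun x => complex.Im (g x)) y)).
split=> [g /L2P[ur ui]|f g Lf /L2P[ur ui]].
  by apply/L2P; split; [exact: (fiber_sum_sqint M0 hM ur)|exact: (fiber_sum_sqint M0 hM ui)].
have /L2P[fhr fhi] := CL _ Lf.
have /L2P[fr fi] := Lf.
have sr := fiber_sum_sqint M0 hM ur.
have si := fiber_sum_sqint M0 hM ui.
set a := (fun x => complex.Re (f x)) in fr.
set b := (fun x => complex.Im (f x)) in fi.
set u := (fun x => complex.Re (g x)) in ur sr.
set v := (fun x => complex.Im (g x)) in ui si.
have adj w r : sqint (w \o h) -> sqint w -> sqint r ->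
    \int[mu]_x (w (h x) * r x) = \int[mu]_x (w x * fiber_sum h r x).
  exact: (fiber_sum_adjoint M0 hM).
rewrite /L2_inner; congr Complex.
  transitivity (\int[mu]_x (a (h x) * u x + b (h x) * v x)).
    apply: eq_Rintegral => x _; rewrite /composition_operator /a /b /u /v /=.
    by case: (f _) => ? ?; case: (g _) => ? ? /=; ring.
  transitivity (\int[mu]_x (a x * fiber_sum h u x + b x * fiber_sum h v x)); last first.
    apply: eq_Rintegral => x _; rewrite /a /b /u /v /=.
    by case: (f _) => ? ? /=; ring.
  by rewrite !RintegralD// ?adj//; exact: integrable_mul.
transitivity (\int[mu]_x (b (h x) * u x - a (h x) * v x)).
  apply: eq_Rintegral => x _; rewrite /composition_operator /a /b /u /v /=.
  by case: (f _) => ? ?; case: (g _) => ? ? /=; ring.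
transitivity (\int[mu]_x (b x * fiber_sum h u x - a x * fiber_sum h v x)); last first.
  apply: eq_Rintegral => x _; rewrite /a /b /u /v /=.
  by case: (f _) => ? ? /=; ring.
by rewrite !RintegralB// ?adj//; exact: integrable_mul.
Qed.

(** Let [C] be the operator. Pairing with the indicator [e] of [y] isolates the value
at [y], and [<e, S^n C^n f> = <C^n e, C^n f>] is an integral over the preimage of
[y] under [h^n], on which [C^n f] takes the single value [f y]. *)
Lemma adjoint_iter_composition S n f y :
  is_adjoint (L2 mu) (L2_inner mu) Ch S -> L2 mu f ->
  iter n S (iter n Ch f) y = real_complex R (preim_mass n y / mass y) * f y.
Proof.
move=> [SL adj] Lf.
have SnL g : L2 mu g -> L2 mu (iter n S g).
  by move=> Lg; elim: n => //= n; exact: SL.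
have adjn l e g : L2 mu e -> L2 mu g ->
    L2_inner mu (iter l Ch e) g = L2_inner mu e (iter l S g).
  elim: l e g => //= l IHl e g Le Lg.
  rewrite adj//; last exact: iter_composition_L2.
  by rewrite IHl// -?iterSr//; exact: SL.
have := adjn n _ _ (L2_point y) (iter_composition_L2 n Lf).
rewrite iter_composition_indC iter_compositionE.
rewrite (@inner_indC _ _ (f y)); last by move=> x /= ->.
rewrite (@inner_indC _ _ (iter n S (f \o iter n h) y)); last by move=> x /= ->.
rewrite -/(mass y) -/(preim_mass n y) => -[er ei].
have m0 : mass y != 0 by rewrite gt_eqF ?mass_gt0.
apply/eqP; rewrite eq_complex; move: er ei.
case: (f y) => a b; case: (iter _ _ _ _) => a' b' /=.
rewrite !mul0r subr0 addr0 => er ei; apply/andP; split; apply/eqP; apply: (mulIf m0).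
  by rewrite -er mulrAC divfK// mulrC.
by apply: oppr_inj; rewrite -!mulNr -ei mulrAC divfK// !mulNr mulrC.
Qed.

(** By [adjoint_iter_composition], the defining sum of an [m]-isometry is
multiplication by the function whose value at [y] is the sum below divided by
[mass y]. *)
Lemma m_isometry_compositionP m : m_isometry (L2 mu) (L2_inner mu) m Ch <->
  forall y, \sum_(0 <= n < m.+1) (-1) ^+ n * 'C(m, n)%:R * preim_mass n y = 0.
Proof.
have sumE S f y : is_adjoint (L2 mu) (L2_inner mu) Ch S -> L2 mu f ->
  (\sum_(0 <= n < m.+1)
        ((-1) ^+ n * 'C(m, n)%:R : R[i]) *: iter n S (iter n Ch f)) y =
  real_complex R
    ((\sum_(0 <= n < m.+1) (-1) ^+ n * 'C(m, n)%:R * preim_mass n y) / mass y) * f y.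
  move=> adj Lf; rewrite fct_sumE mulr_suml rmorph_sum mulr_suml.
  apply: eq_bigr => n _; rewrite scalrfctE (adjoint_iter_composition n y adj Lf).
  rewrite -[LHS]/(_ * _) -[in RHS]mulrA !rmorphM/=.
  by rewrite rmorphXn rmorphN rmorph1 rmorph_nat !mulrA.
split=> [[_ [S adj H]] y|H].
  have /(congr1 (fun g => g y)) := H _ (L2_point y).
  rewrite sumE//; last exact: L2_point.
  rewrite /indC indicE mem_set// => /eqP.
  rewrite eq_complex /= mulr1.
  have m0 : mass y != 0 by rewrite gt_eqF ?mass_gt0.
  by rewrite mulr0 subr0 mulf_eq0 invr_eq0 (negbTE m0) orbF => /andP[/eqP].
split=> //; have [S adj] := composition_adjoint_exists.
by exists S => // f Lf; apply/funext => y; rewrite sumE// H mul0r rmorph0 mul0r.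
Qed.

End CompositionOperator.
End DiscreteL2.

(** * The graph with a loop at the root *)

Section OneCircuit.
Variables (R : realType) (eta : option nat).
Local Notation X := (vertex 0 eta).
Local Notation root := (@x_circ 0 eta ord0).
Local Notation phi := (@phi 0 eta).
Variable mu : {measure set X -> \bar R}.
Hypothesis mu_point : forall x : X, (0 < mu [set x] < +oo)%E.
Hypothesis Cphi_bounded :
  bounded_operator (L2 mu) (L2_inner mu) (composition_operator phi).

Lemma phi_eq_root (x : X) : phi x = root <-> x = root \/ exists b, x = x_branch 0 b 0.
Proof.
have o1 (i : 'I_1) : i = ord0 by exact: ord1.
case: x => [i|[b [|j]]] /=.
- by rewrite (o1 i) eqxx (o1 ord_max); split=> // _; left.
- by rewrite (o1 ord_max); split=> // _; right; exists b.
- by split=> // -[//|[b' []]].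
Qed.

Lemma phi_eq_branch (x : X) b j : phi x = x_branch 0 b j <-> x = x_branch 0 b j.+1.
Proof.
case: x => [i|[b' [|l]]] /=; rewrite /x_circ /x_branch; first by case: ifP.
  by split.
by split=> [[-> ->]|[-> ->]].
Qed.

Lemma preim_branch n b j :
  iter n phi @^-1` [set x_branch 0 b j] = [set x_branch 0 b (j + n)].
Proof.
elim: n j => [|n IHn] j; first by rewrite addn0.
have /seteqP[I1 I2] := IHn j.+1; rewrite addnS -addSn.
apply/seteqP; split=> x /=.
  by move=> /phi_eq_branch; exact: I1.
by move=> ?; apply/phi_eq_branch; exact: I2.
Qed.

(** The family of branches is extended by empty sets to all of [nat], so that the
levels become countable unions to which additivity of the measure applies. *)
Definition level_branch (n i : nat) : set X :=
  [set x | exists2 b : branches eta, val b = i & x = x_branch 0 b n].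

Definition level (n : nat) : set X := \bigcup_i level_branch n i.

Lemma level_branchE n (b : branches eta) :
  level_branch n (val b) = [set x_branch 0 b n].
Proof.
apply/seteqP; split=> x /=; first by move=> [b' /val_inj ->].
by move=> ->; exists b.
Qed.

Lemma level_branch0 n i : ~~ in_branches eta i -> level_branch n i = set0.
Proof.
move=> /negP iN; apply/seteqP; split=> // x [b bi _].
by apply: iN; rewrite -bi; exact: valP b.
Qed.

(** A point is sent to the root in [n + 1] steps when it is already there after [n]
steps, or is then at the start of a branch. *)
Lemma preim_rootS n : iter n.+1 phi @^-1` [set root] =
  iter n phi @^-1` [set root] `|` level n.
Proof.
apply/seteqP; split=> x /=.
  move=> /phi_eq_root[xr|[b xb]]; [by left|right].
  have /seteqP[/(_ _ xb) /= xE _] := preim_branch n b 0.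
  by exists (val b) => //; rewrite level_branchE.
move=> [->|[_ _ [b _ ->]]]; apply/phi_eq_root; [by left|right].
by exists b; have /seteqP[_] := preim_branch n b 0; apply.
Qed.

Lemma preim_root_level_disjoint n :
  [disjoint iter n phi @^-1` [set root] & level n].
Proof.
apply/disj_setPS => x [/= xr [i _ [b _ xb]]].
have /seteqP[_ /(_ _ xb)/=] := preim_branch n b 0.
by rewrite xr.
Qed.

Let mX (A : set X) : measurable A. Proof. by []. Qed.

Definition weight (b : branches eta) (j : nat) : R := fine (mu [set x_branch 0 b j]).
Definition level_mass (n : nat) : R := fine (mu (level n)).
Definition level_branch_mass (i n : nat) : R := fine (mu (level_branch n i)).

Local Notation preim_mass := (preim_mass mu phi).
Let preim_fin n y : mu (iter n phi @^-1` [set y]) \is a fin_num.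
Proof. exact: mu_preim_fin. Qed.

Lemma mu_level_fin n : mu (level n) \is a fin_num.
Proof.
rewrite ge0_fin_numE//.
have := preim_fin n.+1 root; rewrite ge0_fin_numE//; apply: le_lt_trans.
by apply: le_measure; rewrite ?inE//= preim_rootS; exact: subsetUr.
Qed.

Lemma level_mass_fdiff n : level_mass n = fdiff (preim_mass^~ root) n.
Proof.
rewrite /fdiff /preim_mass preim_rootS measureU//; last first.
  exact/disj_set2P/preim_root_level_disjoint.
by rewrite fineD ?preim_fin ?mu_level_fin// addrC addKr.
Qed.

Lemma level_mass_cvg n :
  \sum_(0 <= i < N) level_branch_mass i n @[N --> \oo] --> level_mass n.
Proof.
have fin i : mu (level_branch n i) \is a fin_num.
  rewrite ge0_fin_numE//; apply: (@le_lt_trans _ _ (mu (level n))).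
    by apply: le_measure; rewrite ?inE//; exact: bigcup_sup.
  by rewrite -ge0_fin_numE// mu_level_fin.
have tI : trivIset setT (level_branch n).
  move=> i j _ _ [x [[b <- ->] [b' <- []]]].
  by move=> ->.
have := @measure_semi_sigma_additive _ _ _ mu _ (fun i => mX _) tI (mX _).
rewrite -/(level n) -[mu (level n)]fineK ?mu_level_fin// => /fine_cvgP[_].
apply: cvg_trans; apply: near_eq_cvg; apply: nearW => N /=.
by rewrite /level_branch_mass sum_fine.
Qed.

Lemma weight_gt0 b j : 0 < weight b j.
Proof. exact: mass_gt0. Qed.

(** At the points of a branch the criterion of [m_isometry_compositionP] gives order
[m.+1] of differences; the drop to order [m] comes from the root, where the
criterion says that nonnegative constants have sum [0]. *)
Lemma m_isometry_fdiffP m :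
  m_isometry (L2 mu) (L2_inner mu) m.+1 (composition_operator phi) <->
  forall b, iter m fdiff (weight b) =1 (fun=> 0).
Proof.
have PE y : \sum_(0 <= n < m.+2) (-1) ^+ n * 'C(m.+1, n)%:R * preim_mass n y = 0 <->
    iter m.+1 fdiff (preim_mass^~ y) 0%N = 0.
  rewrite iter_fdiff_sum; split=> [->|/eqP]; first by rewrite mulr0.
  by rewrite mulf_eq0 signr_eq0 => /eqP.
have branchE b j : iter m.+1 fdiff (preim_mass^~ (x_branch 0 b j)) 0%N =
    iter m.+1 fdiff (weight b) j.
  rewrite -[RHS]iter_fdiff_shift; apply: eq_iter_fdiff => n.
  by rewrite /preim_mass preim_branch.
have rootE : iter m.+1 fdiff (preim_mass^~ root) 0%N = iter m fdiff level_mass 0%N.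
  by rewrite iterSr; apply: eq_iter_fdiff => n; rewrite level_mass_fdiff.
have lb b : level_branch_mass (val b) =1 weight b.
  by move=> n; rewrite /level_branch_mass level_branchE.
have lb0 i : ~~ in_branches eta i -> forall j, iter m fdiff (level_branch_mass i) j = 0.
  move=> iN; apply/iter_fdiff_eq0P; exists 0; first by rewrite size_poly0.
  by move=> j; rewrite horner0 /level_branch_mass level_branch0// measure0.
have cvgD := cvg_iter_fdiff (n := m) level_mass_cvg.
rewrite (m_isometry_compositionP mX (pcan_inj (@pickleK X)) mu_point Cphi_bounded).
split=> [H b|H y]; last first.
  apply/PE; case: y => [i|[b j]]; last first.
    by rewrite -/(x_branch 0 b j) branchE /= /fdiff !H subrr.
  rewrite (ord1 i) rootE.
  have z : \sum_(0 <= i < N) iter m fdiff (level_branch_mass i) 0%N @[N --> \oo] --> (0 : R).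
    rewrite (_ : (fun N => _) = (fun=> 0)); first exact: cvg_cst.
    apply/funext => N; rewrite big1// => l _.
    have [lin|/lb0 -> //] := boolP (in_branches eta l).
    by rewrite -(H (exist _ l lin) 0%N); exact: (eq_iter_fdiff m (lb (exist _ l lin))).
  exact: cvg_unique (cvgD 0%N) z.
have {}H y := (PE y).1 (H y).
have Db0 : forall b, iter m.+1 fdiff (weight b) =1 (fun=> 0).
  by move=> b' j; rewrite -branchE H.
have ge0 i : 0 <= iter m fdiff (level_branch_mass i) 0%N.
  have [iin|/lb0 -> //] := boolP (in_branches eta i).
  rewrite [leRHS](eq_iter_fdiff m (lb (exist _ i iin))).
  exact: (fdiff_const_ge0 (@weight_gt0 _) (Db0 _)).
have D0 : iter m fdiff (weight b) 0%N = 0.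
  rewrite -(eq_iter_fdiff m (lb b)).
  apply: (@cvg_sum_ge0_eq0 _ (fun i => iter m fdiff (level_branch_mass i) 0%N)) => //.
  by have := cvgD 0%N; rewrite -rootE H.
(* the [m]-th difference is constant along a branch, so its value at [0] decides *)
by elim=> [//|j <-]; apply/eqP; rewrite -subr_eq0 -(Db0 b j).
Qed.

End OneCircuit.

Theorem corollary2p11 (R : realType) (k : nat) (hkappa : k.+1 = 1%N)
  (eta : option nat) (heta : eta <> Some 0%N)
  (mu : {measure set (vertex k eta) -> \bar R})
  (hmu : forall x : vertex k eta, (0 < mu [set x] < +oo)%E)
  (hC : bounded_operator (L2 mu) (L2_inner mu)
          (composition_operator (@phi k eta)))
  (m : nat) (hm : (2 <= m)%N) :
  (m_isometry (L2 mu) (L2_inner mu) m (composition_operator (@phi k eta)) <->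
    forall i : branches eta,
      polynomial_of_degree_le (m - 2)
        (fun j : nat => fine (mu [set x_branch k i j]))) /\
  ((forall i : branches eta,
      polynomial_of_degree_le (m - 2)
        (fun j : nat => fine (mu [set x_branch k i j]))) ->
   (exists i0 : branches eta,
      polynomial_of_degree (m - 2)
        (fun j : nat => fine (mu [set x_branch k i0 j]))) ->
   strict_m_isometry (L2 mu) (L2_inner mu) m
     (composition_operator (@phi k eta))).
Proof.
case: k hkappa mu hmu hC => // _ mu hmu hC.
case: m hm => [//|[//|n]] _; rewrite -addn2 addnK addn2.
have isoP l := m_isometry_fdiffP hmu hC l.
have degP : (forall b, iter n.+1 fdiff (weight mu b) =1 (fun=> 0)) <->
    forall b, polynomial_of_degree_le n (weight mu b).
  by split=> H b; apply/iter_fdiff_eq0P; exact: H.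
have iso_deg := iff_trans (isoP n.+1) degP.
split=> // deg_le [b [p szp pE]]; split; first exact/iso_deg.
right; split=> //= /isoP /(_ b) /iter_fdiff_eq0P[p' szp' p'E].
have : p - p' = 0 by apply: polynomial_eq0 => j; rewrite !hornerE pE p'E subrr.
by move=> /subr0_eq pp'; move: szp'; rewrite -pp' szp ltnn.
Qed.
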